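(* For every real number $x>0$, $$\frac{1}{2x}-\frac{1}{12x^2}<\psi(x+1)-\ln x<\frac{1}{2x}$$ and $$\frac{1}{2x^2}-\frac{1}{6x^3}<\frac{1}{x}-\psi'(x+1)<\frac{1}{2x^2}-\frac{1}{6x^3}+\frac{1}{30x^5}.$$
   Context: $\psi=\frac{\Gamma'}{\Gamma}$ is the digamma function, i.e. the logarithmic derivative of the gamma function $\Gamma(x)=\int_0^\infty t^{x-1}e^{-t}\,dt$ for $x>0$; $\psi'$ is its derivative (the trigamma function); $\ln$ is the natural logarithm. *)

(* Defs.v *)
From HB Require Import structures.
From mathcomp Require Import all_boot all_order all_algebra.
From mathcomp Require Import all_classical all_reals all_analysis.

Set Implicit Arguments.
Unset Strict Implicit.
Unset Printing Implicit Defensive.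

Import Order.TTheory GRing.Theory Num.Theory.
Import numFieldNormedType.Exports.

Local Open Scope classical_set_scope.
Local Open Scope ring_scope.

(* [Rintegral] and [derive1] are total operators: these definitions carry their
   usual meaning for x > 0, where the integral is finite and Gamma is smooth. *)

Definition Gamma (R : realType) (x : R) : R :=
  \int[@lebesgue_measure R]_(t in `]0, +oo[) (t `^ (x - 1) * expR (- t)).

Definition digamma (R : realType) (x : R) : R := derive1 (@Gamma R) x / Gamma x.

Definition trigamma (R : realType) (x : R) : R := derive1 (@digamma R) x.

(* Main.v *)
Require Import Defs.
From HB Require Import structures.
From mathcomp Require Import all_boot all_order all_algebra.
From mathcomp Require Import all_classical all_reals all_analysis.
From mathcomp Require Import measurable_realfun ring lra.

Set Implicit Arguments.
Unset Strict Implicit.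
Unset Printing Implicit Defensive.

Import Order.TTheory GRing.Theory Num.Theory.
Import numFieldNormedType.Exports.

Local Open Scope classical_set_scope.
Local Open Scope ring_scope.

(** Each of the four inequalities says that some error term [h] is negative,
    and [h] is negative as soon as it tends to [0] at infinity and satisfies
    [h y < h (y + 1)] for all [y > 0]: the values [h (x + n)] then climb to
    their limit [0] from below ([lt0_of_increasing_shift]).

    The increments [h (y + 1) - h y] are elementary, because
    [psi (y + 1) = psi y + 1 / y] and [psi' (y + 1) = psi' y - 1 / y ^ 2]
    ([digammaD1], [trigammaD1]). For trigamma they are rational functions that
    are visibly positive. For digamma, with [w = (y + 1) / y], they are the
    gaps in the inequalities
    [(w - 1/w)/2 - ((w - 1)^2 - (1 - 1/w)^2)/12 < ln w < (w - 1/w)/2]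
    for [w > 1] ([ln_gt_half_subV], [ln_lt_half_subV]).

    The decay at infinity needs only crude bounds on [psi] and [psi'], and these
    are moment estimates. Under the probability density proportional to
    [t^(x-1) e^(-t)], the mean of [ln t] is [psi x] and its variance is
    [psi' x], while the means of [t] and [1/t] are [x] and [1/(x-1)]. The mean
    is located by integrating [1 - y/t <= ln (t/y) <= t/y - 1]
    ([digamma_bounds]). The variance is nonnegative and at most the second
    moment about [ln x], which is controlled by integrating
    [(ln u)^2 <= u - 2 + 1/u] at [u = t/x] ([trigamma_bounds]).

    The analytic input is differentiation under the integral sign
    ([is_derive_gamma_deriv]) and the functional equation of Gamma ([GammaD1]).
    Both rest on one estimate: [|ln t|^k t^(x-1) e^(-t)] is at most a constant
    times [e^(-t/2)], uniformly for [x] in a compact interval inside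
    [(1, +oo)] ([gamma_integrand_bound]). Arguments above [1] suffice, since
    the theorem evaluates [psi] and [psi'] at [x + 1]. *)

(** * Elementary inequalities *)

Lemma gt0_of_derive_gt0 (R : realType) (f f' : R -> R) (w : R) : 1 < w ->
  f 1 = 0 -> (forall t : R, 1 <= t -> is_derive t 1 f (f' t)) ->
  (forall t, 1 < t -> 0 < f' t) -> 0 < f w.
Proof.
move=> w1 f1 df f'0.
have cf : {within `[1, w], continuous f}.
  apply: derivable_within_continuous => t; rewrite in_itv/= => /andP[t1 _].
  by have [] := df t t1.
have [|c cw] := MVT (df := f') w1 _ cf.
  by move=> t; rewrite in_itv/= => /andP[/ltW t1 _]; exact: df.
rewrite f1 subr0 => ->; apply: mulr_gt0; last by rewrite subr_gt0.
by apply: f'0; move: cw; rewrite in_itv/= => /andP[].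
Qed.

(** The difference vanishes at [1] and has derivative [(1 - 1/t)^2 / 2]. With
    [w = (y + 1) / y] this is the trapezoid bound for the integral of the convex
    function [1/t] over [[y, y + 1]]. *)
Lemma ln_lt_half_subV (R : realType) (w : R) : 1 < w -> ln w < (w - w^-1) / 2.
Proof.
move=> w1; rewrite -subr_gt0.
apply: (@gt0_of_derive_gt0 R (fun t => (t - t^-1) / 2 - ln t)
  (fun t => (1 - t^-1) ^+ 2 / 2)) => //.
- by rewrite invr1 subrr mul0r ln1 subrr.
- move=> t t1; have t0 : 0 < t by apply: lt_le_trans t1.
  have tn0 : t != 0 by rewrite gt_eqF.
  have dV := @is_deriveV R id t 1 1 tn0 (is_derive_id _ _).
  have dl := is_derive1_ln t0.
  apply: (is_derive_eq (is_deriveB (is_deriveM (is_deriveB (is_derive_id t 1) dV)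
    (is_derive_cst (2^-1 : R) t 1)) dl)).
  rewrite /GRing.scale/= /cst; field.
  exact: tn0.
- move=> t t1; have t0 : 0 < t by apply: lt_trans t1.
  by rewrite divr_gt0// exprn_even_gt0//= subr_eq0 eq_sym invr_eq1 gt_eqF.
Qed.

(** The trapezoid bound with its endpoint correction: the difference vanishes at
    [1] and its derivative is the perfect power [(t - 1)^4 / (6 t^3)]. *)
Lemma ln_gt_half_subV (R : realType) (w : R) : 1 < w ->
  (w - w^-1) / 2 - ((w - 1) ^+ 2 - (1 - w^-1) ^+ 2) / 12 < ln w.
Proof.
move=> w1; rewrite -subr_gt0.
apply: (@gt0_of_derive_gt0 R (fun t => ln t -
    ((t - t^-1) / 2 - ((t - 1) ^+ 2 - (1 - t^-1) ^+ 2) / 12))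
  (fun t => (t - 1) ^+ 4 / (6 * t ^+ 3))) => //.
- by rewrite invr1 ln1 !subrr !mul0r !subrr.
- move=> t t1; have t0 : 0 < t by apply: lt_le_trans t1.
  have tn0 : t != 0 by rewrite gt_eqF.
  have dV := @is_deriveV R id t 1 1 tn0 (is_derive_id _ _).
  have dl := is_derive1_ln t0.
  apply: (is_derive_eq (is_deriveB dl (is_deriveB
    (is_deriveM (is_deriveB (is_derive_id t 1) dV) (is_derive_cst (2^-1 : R) t 1))
    (is_deriveM (is_deriveB
      (is_deriveX 2 (is_deriveB (is_derive_id t 1) (is_derive_cst (1 : R) t 1)))
      (is_deriveX 2 (is_deriveB (is_derive_cst (1 : R) t 1) dV)))
      (is_derive_cst (12^-1 : R) t 1))))).
  rewrite /GRing.scale/= !fctE /cst; field.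
  exact: tn0.
- move=> t t1; have t0 : 0 < t by apply: lt_trans t1.
  apply: divr_gt0; last by rewrite mulr_gt0 ?exprn_gt0.
  by rewrite exprn_gt0 ?subr_gt0.
Qed.

(** The right-hand side is [(v - 1/v)^2] for [v = sqrt u], so for [u > 1] this is
    the square of [2 ln v < v - 1/v]; both sides are invariant under
    [u -> 1/u]. *)
Lemma sqr_ln_le (R : realType) (u : R) : 0 < u -> ln u ^+ 2 <= u - 2 + u^-1.
Proof.
have main (v : R) : 1 < v -> ln (v ^+ 2) ^+ 2 <= v ^+ 2 - 2 + (v ^+ 2)^-1.
  move=> v1; have v0 : 0 < v by apply: lt_trans v1.
  have vn0 : v != 0 by rewrite gt_eqF.
  have := ln_lt_half_subV v1; have := ln_gt0 v1; rewrite lnXn//.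
  have -> : v ^+ 2 - 2 + (v ^+ 2)^-1 = (v - v^-1) ^+ 2 by field.
  by move=> l0 l1; rewrite ler_sqr ?nnegrE; lra.
have ge1 (x : R) : 1 < x -> ln x ^+ 2 <= x - 2 + x^-1.
  move=> x1; rewrite -(@sqr_sqrtr _ x) ?(ltW (lt_trans _ x1))//; apply: main.
  by rewrite -[ltLHS]sqrtr1 ltr_sqrt// (lt_trans _ x1).
move=> u0; case: (ltgtP u 1) => [u1|/ge1//|->]; last first.
  by rewrite ln1 expr0n/= invr1; lra.
have := ge1 u^-1; rewrite invf_gt1// => /(_ u1).
by rewrite lnV// sqrrN invrK; lra.
Qed.

(** The sequence [h (x + n)] increases to [0], so its terms are negative. The
    explicit rate [C / y] only serves to say that [h] tends to [0]. *)
Lemma lt0_of_increasing_shift (R : realType) (h : R -> R) (C x : R) : 0 < x ->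
  (forall y, 0 < y -> h y < h (y + 1)) ->
  (forall y, 1 < y -> `|h y| <= C / y) -> h x < 0.
Proof.
move=> x0 hinc hC.
apply: lt_le_trans (hinc x x0) _.
have mono n : h (x + 1) <= h (x + 1 + n%:R).
  elim: n => [|n IH]; first by rewrite addr0.
  apply: le_trans IH _; rewrite -natr1 addrA; apply/ltW/hinc.
  by have := ler0n R n; lra.
rewrite leNgt; apply/negP => h0.
(* A positive value [h (x + 1)] would bound from below all later values, but
   [C / (x + 1 + n)] drops under it once [n] exceeds [C / h (x + 1)]. *)
have C0 : 0 <= C.
  have := hC (x + 1); rewrite ltrDr => /(_ x0) H.
  have := le_trans (normr_ge0 _) H; rewrite pmulr_lge0// invr_gt0; lra.
pose n := Num.bound (C / h (x + 1)).
have := archi_boundP (divr_ge0 C0 (ltW h0)); rewrite -/n => nP.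
have nx : 1 < x + 1 + n%:R by have := ler0n R n; lra.
have := le_trans (ler_norm _) (hC _ nx); apply/negP; rewrite -ltNge.
apply: lt_le_trans (mono n); rewrite ltr_pdivrMr; last lra.
by rewrite mulrC -ltr_pdivrMr//; lra.
Qed.

(** * The integrands of Gamma and of its derivatives *)

Definition gamma_integrand (R : realType) (k : nat) (x t : R) : R :=
  ln t ^+ k * (t `^ (x - 1) * expR (- t)).

(** The [k]-th derivative of Gamma at [x > 1], encoded as an integral and not as
    an iterated derivative so that one differentiation lemma serves every order
    and pointwise inequalities in [t] can be integrated. *)
Definition gamma_deriv (R : realType) (k : nat) (x : R) : R :=
  \int[@lebesgue_measure R]_(t in `]0, +oo[) gamma_integrand k x t.

Lemma exprn_le_fact_expR (R : realType) (n : nat) (x : R) : 0 <= x ->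
  x ^+ n <= n`!%:R * expR x.
Proof.
move=> x0; case: n => [|n].
  by rewrite expr0 fact0 mul1r (le_trans _ (expR_ge1Dx x))// lerDl.
rewrite mulrC -ler_pdivrMr ?ltr0n ?fact_gt0//.
by apply: le_trans (expR_ge1Dxn n x0); rewrite lerDr.
Qed.

(** The common domination behind all integrability and differentiation
    statements. In terms of [s = ln t], the factor [|s|^k] costs at most
    [e^(d |s|)] with [d = u - 1]. For [t <= 1] this is [t^(-d)], absorbed by
    [t^(x-1) <= t^d]; for [t > 1] the product is at most a power of [t], which
    [e^(t/2)] dominates. *)
Lemma gamma_integrand_bound (R : realType) (k : nat) (u v : R) : 1 < u ->
  exists K : R, 0 <= K /\ forall x t, u <= x <= v -> 0 < t ->
    `|gamma_integrand k x t| <= K * expR (- (t / 2)).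
Proof.
move=> u1; pose d := u - 1; have d0 : 0 < d by rewrite subr_gt0.
pose N := Num.bound (d + `|v|).
have NP : d + `|v| < N%:R by apply: archi_boundP; rewrite addr_ge0 // ltW.
pose A : R := k`!%:R / d ^+ k; pose B : R := 2 ^+ N * N`!%:R.
have A0 : 0 <= A by rewrite divr_ge0 ?ler0n// exprn_ge0// ltW.
have B0 : 0 <= B by rewrite mulr_ge0 ?exprn_ge0.
exists (A * (1 + B)); split; first by rewrite mulr_ge0// addr_ge0.
move=> x t /andP[ux xv] t0; set s := ln t.
have -> : `|gamma_integrand k x t| = `|s| ^+ k * expR ((x - 1) * s - t).
  rewrite /gamma_integrand normrM normrX.
  rewrite [`|_ * _|]ger0_norm ?mulr_ge0 ?powR_ge0 ?expR_ge0//.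
  by rewrite /powR gt_eqF// expRD.
have sk : `|s| ^+ k <= A * expR (d * `|s|).
  rewrite /A mulrAC ler_pdivlMr ?exprn_gt0// mulrC -exprMn.
  by apply: exprn_le_fact_expR; rewrite mulr_ge0 // ltW.
have e0 := expR_gt0 ((x - 1) * s - t).
apply: (le_trans (ler_wpM2r (ltW e0) sk)).
clearbody A; rewrite -!mulrA; apply: ler_wpM2l => //.
rewrite -expRD [leRHS]mulrDl mul1r.
have [s0|s0] := lerP s 0.
  apply: (@le_trans _ _ (expR (- (t / 2)))).
    rewrite ler_expR ler0_norm//.
    have h : (x - u) * s <= 0 by rewrite mulr_ge0_le0// subr_ge0.
    by rewrite /d; nra.
  by rewrite lerDl mulr_ge0 ?expR_ge0.
apply: (@le_trans _ _ (B * expR (- (t / 2)))); last first.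
  by rewrite lerDr expR_ge0.
apply: (@le_trans _ _ (expR (N%:R * s) * expR (- t))).
  rewrite -expRD ler_expR addrA lerD2r gtr0_norm// -mulrDl ler_wpM2r ?(ltW s0)//.
  by have := ler_norm v; lra.
rewrite expRM_natl lnK ?posrE//.
have -> : t ^+ N = 2 ^+ N * (t / 2) ^+ N by rewrite -exprMn mulrC divfK.
rewrite /B -!mulrA ler_wpM2l ?exprn_ge0//.
have th : 0 <= t / 2 by rewrite divr_ge0// ltW.
apply: (le_trans (ler_wpM2r (expR_ge0 _) (exprn_le_fact_expR N th))).
by rewrite -mulrA -expRD ler_wpM2l ?ler0n// ler_expR; lra.
Qed.

Lemma measurable_gamma_integrand (R : realType) (k : nat) (x : R) (D : set R) :
  measurable_fun D (gamma_integrand k x).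
Proof.
apply: measurable_funTS; apply: measurable_funM.
  by apply: measurable_funX; exact: measurable_ln.
apply: measurable_funM; first exact: measurable_powR.
by apply: measurableT_comp => //; exact: measurable_expR.
Qed.

(** Stated on the closed half-line, as the fundamental theorem of calculus is,
    and reused in this form in the proof of the functional equation. *)
Lemma integral_expRN_half (R : realType) (K : R) : 0 <= K ->
  (\int[@lebesgue_measure R]_(t in `[0%R, +oo[) (K * expR (- (t / 2)))%:E =
   (2 * K)%:E)%E.
Proof.
move=> K0.
have dF (t : R) : is_derive t 1 (fun t => - (2 * K) * expR (- (t / 2)))
    (K * expR (- (t / 2))).
  have D := is_deriveN (is_deriveM (is_derive_id t (1 : R))
    (is_derive_cst (2^-1 : R) t 1)).
  apply: (is_derive_eq (is_deriveM (is_derive_cst (- (2 * K)) t 1)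
    (is_derive1_comp (is_derive_expR _) D))).
  by rewrite /GRing.scale/= !fctE /cst; field.
have cF (g : R) : continuous (fun t : R => g * expR (- (t / 2))).
  move=> t; apply: cvgM; first exact: cvg_cst.
  apply: continuous_comp; last exact: continuous_expR.
  by apply: cvgN; apply: cvgM; [exact: cvg_id|exact: cvg_cst].
rewrite (@ge0_continuous_FTC2y R _ (fun t => - (2 * K) * expR (- (t / 2))) 0 0).
- by rewrite mul0r oppr0 expR0 mulr1 sub0e -EFinN opprK.
- by move=> t _; rewrite mulr_ge0 ?expR_ge0.
- exact/continuous_subspaceT/cF.
- rewrite -[X in _ --> X](mulr0 (- (2 * K))); apply: cvgM; first exact: cvg_cst.
  apply: (@cvg_comp _ _ _ (fun t => t / 2) (fun t => expR (- t)) _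
    (pinfty_nbhs R)).
    exact: gt0_cvgMly.
  exact: cvgr_expR.
- by move=> t _; have [] := dF t.
- exact/cvg_at_right_filter/cF.
- by move=> t _; rewrite derive1E; have [] := dF t.
Qed.

Lemma integrable_expRN_half (R : realType) (K : R) : 0 <= K ->
  (@lebesgue_measure R).-integrable `]0, +oo[
    (EFin \o (fun t => K * expR (- (t / 2)))).
Proof.
move=> K0; have mE : measurable_fun (`]0, +oo[%classic : set R)
    (fun t : R => K * expR (- (t / 2))).
  apply: measurable_funTS; apply: measurable_funM => //.
  apply: measurableT_comp => //; apply: measurableT_comp => //.
  exact: measurable_funM.
apply/integrableP; split; first exact/measurable_EFinP.
under eq_integral do rewrite /= ger0_norm ?mulr_ge0 ?expR_ge0//.
rewrite /= integral_itv_obnd_cbnd ?integral_expRN_half ?ltry//.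
exact/measurable_EFinP.
Qed.

Lemma integrable_gamma_integrand (R : realType) (k : nat) (x : R) : 1 < x ->
  (@lebesgue_measure R).-integrable `]0, +oo[ (EFin \o gamma_integrand k x).
Proof.
move=> x1; have [K [K0 KP]] := gamma_integrand_bound k x x1.
apply: le_integrable (integrable_expRN_half K0) => //.
  by apply/measurable_EFinP; apply: measurable_gamma_integrand.
move=> t; rewrite /= in_itv/= andbT => t0; rewrite lee_fin.
rewrite (ger0_norm (mulr_ge0 K0 (expR_ge0 _))).
by apply: KP; rewrite ?lexx.
Qed.

Lemma is_derive_gamma_integrand (R : realType) (k : nat) (x t : R) : 0 < t ->
  is_derive x 1 (fun x => gamma_integrand k x t) (gamma_integrand k.+1 x t).
Proof.
move=> t0; rewrite /gamma_integrand /powR gt_eqF//.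
have D : is_derive x 1 (fun x => expR ((x - 1) * ln t))
    (expR ((x - 1) * ln t) * ln t).
  have D1 := is_deriveM (is_deriveB (is_derive_id x (1 : R))
    (is_derive_cst (1 : R) x 1)) (is_derive_cst (ln t) x 1).
  apply: (is_derive_eq (is_derive1_comp (is_derive_expR _) D1)).
  by rewrite /GRing.scale/= !fctE /cst; ring.
apply: (is_derive_eq (is_deriveM (is_derive_cst (ln t ^+ k) x 1)
  (is_deriveM D (is_derive_cst (expR (- t)) x 1)))).
by rewrite /GRing.scale/= !fctE /cst exprS; ring.
Qed.

(** Differentiation under the integral sign on a bounded interval around [x] that
    stays away from [1], where the bound on the [k + 1]-st integrand is
    uniform. *)
Lemma is_derive_gamma_deriv (R : realType) (k : nat) (x : R) : 1 < x ->
  is_derive x 1 (gamma_deriv k) (gamma_deriv k.+1 x).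
Proof.
move=> x1; pose u := (1 + x) / 2; pose v := x + 1.
have u1 : 1 < u by rewrite /u; lra.
have Ix : `]u, v[%classic x by rewrite /= in_itv/= /u /v; apply/andP; split; lra.
have [K [K0 KP]] := gamma_integrand_bound k.+1 v u1.
have int y : `]u, v[%classic y ->
    (@lebesgue_measure R).-integrable `]0, +oo[ (EFin \o gamma_integrand k y).
  rewrite /= in_itv/= => /andP[uy _].
  by apply: integrable_gamma_integrand; apply: lt_trans uy.
have d1E (y t : R) : 0 < t ->
    partial1of2 (gamma_integrand k) y t = gamma_integrand k.+1 y t.
  move=> t0; rewrite /partial1of2 derive1E.
  by have [_ ->] := is_derive_gamma_integrand k y t0.
have der y t : `]u, v[%classic y -> `]0, +oo[%classic t ->
    derivable (gamma_integrand k ^~ t) y 1.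
  rewrite /= !in_itv/= andbT => _ t0.
  by have [] := is_derive_gamma_integrand k y t0.
have ub y t : `]u, v[%classic y -> `]0, +oo[%classic t ->
    `|partial1of2 (gamma_integrand k) y t| <= K * expR (- (t / 2)).
  rewrite /= !in_itv/= andbT => /andP[uy yv] t0.
  by rewrite d1E// KP// !ltW.
have G0 t : 0 <= K * expR (- (t / 2)) by rewrite mulr_ge0 ?expR_ge0.
have intG := integrable_expRN_half K0.
apply: DeriveDef.
  exact: (derivable_under_integral (mu := lebesgue_measure)
    _ Ix int der G0 intG ub).
rewrite -derive1E.
rewrite (differentiation_under_integral (mu := lebesgue_measure)
  _ Ix int der G0 intG ub)//.
apply: eq_Rintegral => t; rewrite inE/= in_itv/= andbT => t0.
exact: d1E.
Qed.

(** * Functional equation and positivity of Gamma *)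

Lemma gamma_deriv0 (R : realType) (x : R) : gamma_deriv 0 x = Gamma x.
Proof. by apply: eq_Rintegral => t _; rewrite /gamma_integrand expr0 mul1r. Qed.

(** The integrand [(y t^(y-1) - t^y) e^(-t)] is the derivative of [t^y e^(-t)],
    which vanishes at both ends of the half-line. It changes sign, whereas the
    fundamental theorem of calculus on a half-line is for nonnegative
    integrands; adding [K e^(-t/2)], with [K] from the domination, makes it
    nonnegative and contributes the same [2 K] to both sides. *)
Lemma GammaD1 (R : realType) (y : R) : 1 < y -> Gamma (y + 1) = y * Gamma y.
Proof.
move=> y1; have y0 : 0 < y by apply: lt_trans y1.
have y11 : 1 < y + 1 by rewrite ltrDr.
have [K [K0 KP]] := gamma_integrand_bound 0 (y + 1) y11.
have {}KP (t : R) : 0 < t -> t `^ y * expR (- t) <= K * expR (- (t / 2)).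
  move=> t0; have := KP (y + 1) t; rewrite lexx => /(_ isT t0).
  by apply: le_trans; rewrite /gamma_integrand expr0 mul1r addrK ler_norm.
pose F t : R := t `^ y * expR (- t) - 2 * K * expR (- (t / 2)).
pose f t : R := (y * t `^ (y - 1) - t `^ y) * expR (- t) + K * expR (- (t / 2)).
have cE1 : continuous (fun t : R => expR (- t)).
  move=> t; apply: continuous_comp; last exact: continuous_expR.
  by apply: cvgN; exact: cvg_id.
have cE2 : continuous (fun t : R => expR (- (t / 2))).
  move=> t; apply: continuous_comp; last exact: continuous_expR.
  by apply: cvgN; apply: cvgM; [exact: cvg_id|exact: cvg_cst].
have p0 (p : R) : 0 < p -> (t `^ p @[t --> 0^'+] --> (0 : R) `^ p).
  by move=> p0; rewrite powR0 ?gt_eqF//; exact: powR_cvg0.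
have dF (t : R) : 0 < t -> is_derive t 1 F (f t).
  move=> t0.
  have D1 := is_derive1_comp (is_derive_expR _)
    (is_deriveN (is_derive_id t (1 : R))).
  have D2 := is_derive1_comp (is_derive_expR _)
    (is_deriveN (is_deriveM (is_derive_id t (1 : R))
    (is_derive_cst (2^-1 : R) t 1))).
  apply: (is_derive_eq (is_deriveB (is_deriveM (is_derive1_powR y t0) D1)
    (is_deriveM (is_derive_cst (2 * K) t 1) D2))).
  by rewrite /f /GRing.scale/= !fctE /cst/=; field.
have FTC : \int[@lebesgue_measure R]_(t in `[0%R, +oo[) f t = 0 - F 0.
  apply: Rintegral_ge0_continuous_FTC2y.
  - move=> t; rewrite le_eqVlt => /predU1P[<-|t0].
      rewrite /f !powR0 ?gt_eqF ?subr_gt0//.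
      by rewrite mulr0 subrr mul0r add0r mulr_ge0 ?expR_ge0.
    have : 0 <= y * t `^ (y - 1) * expR (- t).
      by rewrite mulr_ge0 ?expR_ge0// mulr_ge0 ?powR_ge0// ltW.
    by have := KP t t0; rewrite /f mulrBl; lra.
  - apply/continuous_within_itvcyP; split.
      move=> t; rewrite in_itv/= andbT => t0.
      have cp p : {for t, continuous (fun t : R => t `^ p)}.
        apply: differentiable_continuous; apply/derivable1_diffP.
        by apply: derivable_powR; rewrite in_itv/= t0.
      apply: cvgD; last by apply: cvgM; [exact: cvg_cst|exact: cE2].
      apply: cvgM; last exact: cE1.
      by apply: cvgB; [apply: cvgM; [exact: cvg_cst|exact: cp]|exact: cp].
    apply: cvgD; last first.
      by apply: cvgM; [exact: cvg_cst|apply: cvg_at_right_filter; exact: cE2].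
    apply: cvgM; last by apply: cvg_at_right_filter; exact: cE1.
    apply: cvgB; last exact: p0.
    by apply: cvgM; [exact: cvg_cst|apply: p0; rewrite subr_gt0].
  - have lim0 : K * expR (- (t / 2)) @[t --> +oo] --> 0.
      rewrite -[X in _ --> X](mulr0 K); apply: cvgM; first exact: cvg_cst.
      apply: (@cvg_comp _ _ _ (fun t => t / 2) (fun t => expR (- t)) _
        (pinfty_nbhs R)).
        exact: gt0_cvgMly.
      exact: cvgr_expR.
    rewrite -[X in _ --> X](subrr 0); apply: cvgB; last first.
      rewrite -[X in _ --> X](mulr0 2).
      under eq_fun do rewrite -mulrA.
      by apply: cvgM; first exact: cvg_cst.
    apply: (squeeze_cvgr _ (cvg_cst 0) lim0).
    near=> t; rewrite mulr_ge0 ?powR_ge0 ?expR_ge0//=.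
    by apply: KP; near: t; exact: nbhs_pinfty_gt.
  - by move=> t t0; have [] := dF t t0.
  - apply: cvgB.
      apply: cvgM; first exact: p0.
      by apply: cvg_at_right_filter; exact: cE1.
    by apply: cvgM; [exact: cvg_cst|apply: cvg_at_right_filter; exact: cE2].
  - move=> t; rewrite in_itv/= andbT => t0.
    by rewrite derive1E; have [] := dF t t0.
have I0 := integrable_gamma_integrand 0 y1.
have I1 := integrable_gamma_integrand 0 y11.
have I2 := integrable_expRN_half K0.
have I0y : (@lebesgue_measure R).-integrable `]0, +oo[
    (EFin \o (fun t => y * gamma_integrand 0 y t)).
  exact: (integrableZl _ y I0).
have fE (t : R) : 0 < t ->
    f t = y * gamma_integrand 0 y t - gamma_integrand 0 (y + 1) t +
      K * expR (- (t / 2)).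
  by rewrite /f /gamma_integrand expr0 !mul1r addrK mulrBl !mulrA.
have I01 : (@lebesgue_measure R).-integrable `]0, +oo[
    (EFin \o
      (fun t => y * gamma_integrand 0 y t - gamma_integrand 0 (y + 1) t)).
  exact: (integrableB _ I0y I1).
have If : (@lebesgue_measure R).-integrable `]0, +oo[ (EFin \o f).
  apply: eq_integrable (integrableD _ I01 I2) => //.
  by move=> t; rewrite inE/= in_itv/= andbT => t0; rewrite /= fE.
move: FTC; rewrite -Rintegral_itv_obnd_cbnd//.
rewrite (_ : Rintegral _ _ _ =
  y * gamma_deriv 0 y - gamma_deriv 0 (y + 1) + 2 * K).
  rewrite /F powR0 ?gt_eqF// !mul0r oppr0 expR0 !gamma_deriv0; lra.
transitivity (\int[@lebesgue_measure R]_(t in `]0%R, +oo[)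
  (y * gamma_integrand 0 y t - gamma_integrand 0 (y + 1) t +
   K * expR (- (t / 2)))).
  by apply: eq_Rintegral => t; rewrite inE/= in_itv/= andbT => /fE.
rewrite RintegralD// RintegralB// RintegralZl//; congr (_ + _).
rewrite Rintegral_itv_obnd_cbnd//.
by rewrite /Rintegral integral_expRN_half.
Unshelve. all: by end_near. Qed.

Lemma gamma_integrand0_gt0 (R : realType) (x t : R) : 0 < t ->
  0 < gamma_integrand 0 x t.
Proof.
by move=> t0; rewrite /gamma_integrand expr0 mul1r mulr_gt0 ?powR_gt0 ?expR_gt0.
Qed.

(** On [[1, 2]] the integrand is at least [e^(-2)]. *)
Lemma Gamma_gt0 (R : realType) (x : R) : 1 < x -> 0 < Gamma x.
Proof.
move=> x1; rewrite -gamma_deriv0.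
have Ix := integrable_gamma_integrand 0 x1.
have e0 := expR_gt0 (- 2 : R).
apply: (lt_le_trans e0); rewrite -lee_fin /gamma_deriv /Rintegral fineK; last first.
  exact: integrable_fin_num.
have -> : ((expR (- 2))%:E =
    \int[@lebesgue_measure R]_(t in `[1%R, 2%R]) (expR (- 2))%:E)%E.
  rewrite integral_cst//= lebesgue_measure_itv/= lte_fin ltr1n.
  by rewrite -EFinB -EFinM; congr (_%:E); ring.
have mg (D : set R) : measurable_fun D (EFin \o gamma_integrand 0 x).
  by apply/measurable_EFinP; apply: measurable_gamma_integrand.
apply: (@le_trans _ _
  (\int[@lebesgue_measure R]_(t in `[1%R, 2%R]) (gamma_integrand 0 x t)%:E)%E).
  apply: ge0_le_integral => //=.
  - exact: mg.
  - move=> t /=; rewrite in_itv/= => /andP[t1 t2].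
    rewrite lee_fin /gamma_integrand expr0 mul1r.
    apply: (@le_trans _ _ (expR (- t))); first by rewrite ler_expR lerN2.
    rewrite ler_peMl ?expR_ge0// -[leLHS](powRr0 t) ler_powR//; lra.
apply: ge0_subset_integral => //=.
- exact: mg.
- move=> t; rewrite in_itv/= andbT => t0.
  by rewrite lee_fin ltW// gamma_integrand0_gt0.
- by move=> t /=; rewrite !in_itv/= andbT => /andP[t1 _]; apply: lt_le_trans t1.
Qed.

Lemma gamma_integrandM (R : realType) (x t : R) : 0 < t ->
  gamma_integrand 0 (x + 1) t = t * gamma_integrand 0 x t.
Proof.
move=> t0; rewrite /gamma_integrand !expr0 !mul1r mulrA; congr (_ * _).
rewrite -addrAC [LHS]powRD; last by rewrite (gt_eqF t0) implybT.
by rewrite powRr1 1?mulrC// ltW.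
Qed.

(** * Digamma and trigamma in terms of the derivatives of Gamma *)

Lemma digammaE (R : realType) (x : R) : 1 < x ->
  digamma x = gamma_deriv 1 x / Gamma x.
Proof.
move=> x1; rewrite /digamma; congr (_ / _).
rewrite (_ : @Gamma R = gamma_deriv 0); last first.
  by apply/funext => y; rewrite gamma_deriv0.
by rewrite derive1E; have [_ ->] := is_derive_gamma_deriv 0 x1.
Qed.

Lemma is_derive_Gamma (R : realType) (x : R) : 1 < x ->
  is_derive x 1 (@Gamma R) (Gamma x * digamma x).
Proof.
move=> x1; rewrite digammaE// mulrCA mulfV ?mulr1 ?gt_eqF ?Gamma_gt0//.
rewrite (_ : @Gamma R = gamma_deriv 0); first exact: is_derive_gamma_deriv.
by apply/funext => y; rewrite gamma_deriv0.
Qed.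

Lemma is_derive_digamma (R : realType) (x : R) : 1 < x ->
  is_derive x 1 (@digamma R)
    (gamma_deriv 2 x / Gamma x - digamma x ^+ 2).
Proof.
move=> x1; have G0 := Gamma_gt0 x1.
apply: (@near_eq_is_derive _ _ _ (gamma_deriv 1 * (fun y => (Gamma y)^-1))).
  near=> y; rewrite fctE digammaE//.
  by near: y; exact: lt_nbhsr.
have Gn0 : Gamma x != 0 by rewrite gt_eqF.
apply: (is_derive_eq (is_deriveM (is_derive_gamma_deriv 1 x1)
  (is_deriveV Gn0 (is_derive_Gamma x1)))).
by rewrite /GRing.scale/= digammaE//; field.
Unshelve. all: by end_near. Qed.

Lemma trigammaE (R : realType) (x : R) : 1 < x ->
  trigamma x = gamma_deriv 2 x / Gamma x - digamma x ^+ 2.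
Proof.
by move=> x1; rewrite /trigamma derive1E; have [_ ->] := is_derive_digamma x1.
Qed.

Lemma near_eq_is_derive_unique (R : realType) (f g : R -> R) (x df dg : R) :
  (\near x, f x = g x) -> is_derive x 1 f df -> is_derive x 1 g dg -> df = dg.
Proof. by move=> fg [_ <-] [_ <-]; exact: near_eq_derive. Qed.

Lemma is_derive_shift1 (R : realType) (f : R -> R) (x df : R) :
  is_derive (x + 1) 1 f df -> is_derive x 1 (fun y => f (y + 1)) df.
Proof.
move=> D; apply: (is_derive_eq (@is_derive1_comp R f (fun y => y + 1) x _ _ D
  (is_deriveD (is_derive_id x (1 : R)) (is_derive_cst (1 : R) x 1)))).
by rewrite addr0 mulr1.
Qed.

(** The logarithmic derivative of [Gamma (y + 1) = y Gamma y]. *)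
Lemma digammaD1 (R : realType) (y : R) : 1 < y ->
  digamma (y + 1) = digamma y + y^-1.
Proof.
move=> y1; have y11 : 1 < y + 1 by lra.
have G0 := Gamma_gt0 y1.
have y0 : 0 < y by apply: lt_trans y1.
have GE : \near y, Gamma (y + 1) = y * Gamma y.
  by near=> z; apply: GammaD1; near: z; exact: lt_nbhsr.
have := near_eq_is_derive_unique GE (is_derive_shift1 (is_derive_Gamma y11))
  (is_deriveM (is_derive_id y (1 : R)) (is_derive_Gamma y1)).
rewrite /GRing.scale/= GammaD1// mulr1 => E.
apply: (@mulfI _ (y * Gamma y)); first by rewrite mulf_neq0 ?gt_eqF.
by rewrite E; field; rewrite gt_eqF.
Unshelve. all: by end_near. Qed.

Lemma trigammaD1 (R : realType) (y : R) : 1 < y ->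
  trigamma (y + 1) = trigamma y - y ^- 2.
Proof.
move=> y1; have y11 : 1 < y + 1 by lra.
have y0 : y != 0 by rewrite gt_eqF// (lt_trans _ y1).
have dE : \near y, digamma (y + 1) = digamma y + y^-1.
  by near=> z; apply: digammaD1; near: z; exact: lt_nbhsr.
have := near_eq_is_derive_unique dE (is_derive_shift1 (is_derive_digamma y11))
  (is_deriveD (is_derive_digamma y1) (is_deriveV y0 (is_derive_id y (1 : R)))).
by rewrite -!trigammaE// /GRing.scale/= mulr1.
Unshelve. all: by end_near. Qed.

(** * Size of digamma and trigamma at infinity *)

(** The device that turns a pointwise inequality in [t] into one between values
    of Gamma and its derivatives. A list of terms (coefficient, order, argument)
    is allowed because the applications have up to five of them. *)
Lemma gamma_deriv_comb_ge0 (R : realType) (s : seq (R * nat * R)) :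
  (forall p, p \in s -> 1 < p.2) ->
  (forall t : R, 0 < t ->
    0 <= \sum_(p <- s) p.1.1 * gamma_integrand p.1.2 p.2 t) ->
  0 <= \sum_(p <- s) p.1.1 * gamma_deriv p.1.2 p.2.
Proof.
move=> s1 s_ge0.
suff [_ <-] : (@lebesgue_measure R).-integrable `]0, +oo[ (EFin \o
      (fun t => \sum_(p <- s) p.1.1 * gamma_integrand p.1.2 p.2 t)) /\
    \int[@lebesgue_measure R]_(t in `]0, +oo[)
      (\sum_(p <- s) p.1.1 * gamma_integrand p.1.2 p.2 t) =
    \sum_(p <- s) p.1.1 * gamma_deriv p.1.2 p.2.
  by apply: Rintegral_ge0 => t; rewrite /= in_itv/= andbT => /s_ge0.
elim: s s1 {s_ge0} => [|[[a k] x] s IH] s1.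
  rewrite big_nil (_ : (fun t => _) = cst 0); last first.
    by apply/funext => t; rewrite big_nil.
  split; first exact: integrable0.
  by rewrite Rintegral_cst// mul0r.
have [|Is sE] := IH; first by move=> p ps; apply: s1; rewrite inE ps orbT.
have x1 : 1 < x by apply: (s1 (a, k, x)); rewrite inE eqxx.
have Ik := integrable_gamma_integrand k x1.
have Iak : (@lebesgue_measure R).-integrable `]0, +oo[
    (EFin \o (fun t => a * gamma_integrand k x t)).
  exact: (integrableZl _ a Ik).
rewrite big_cons (_ : (fun t => _) = (fun t => a * gamma_integrand k x t +
    \sum_(p <- s) p.1.1 * gamma_integrand p.1.2 p.2 t)); last first.
  by apply/funext => t; rewrite big_cons.
split; first exact: (integrableD _ Iak Is).
by rewrite RintegralD// RintegralZl// sE.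
Qed.

(** Jensen-type bounds: with weight [t^x e^(-t)], the lower one integrates
    [ln (x/t) <= x/t - 1] and the upper one [ln (t/(x+1)) <= t/(x+1) - 1]; the
    scalings [x] and [x + 1] make the linear parts integrate to [0]. *)
Lemma digamma_bounds (R : realType) (x : R) : 1 < x ->
  ln x <= digamma (x + 1) <= ln (x + 1).
Proof.
move=> x1; have x0 : 0 < x by apply: lt_trans x1.
have x11 : 1 < x + 1 by lra.
have x10 : 0 < x + 1 by lra.
have x12 : 1 < x + 1 + 1 by lra.
have G0 := Gamma_gt0 x1; have G1 := Gamma_gt0 x11.
have gE k (t : R) : gamma_integrand k (x + 1) t =
    ln t ^+ k * gamma_integrand 0 (x + 1) t.
  by rewrite /gamma_integrand expr0 mul1r.
have ln_le (u : R) : 0 < u -> ln u <= u - 1.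
  by move=> u0; rewrite -[u in ln u](subrKC 1) le_ln1Dx//; lra.
rewrite digammaE// ler_pdivlMr// ler_pdivrMr//; apply/andP; split.
  have : 0 <= \sum_(p <- [:: (1, 1%N, x + 1); (- (ln x + 1), 0%N, x + 1);
      (x, 0%N, x)]) p.1.1 * gamma_deriv p.1.2 p.2.
    apply: gamma_deriv_comb_ge0 => [p|t t0].
      by rewrite !inE => /or3P[]/eqP->.
    rewrite !big_cons !big_nil/= (gE 1%N) gamma_integrandM//.
    have g0 := gamma_integrand0_gt0 x t0.
    have := ln_le (x / t) (divr_gt0 x0 t0); rewrite ln_div ?posrE// -subr_ge0.
    rewrite -(pmulr_lge0 _ (mulr_gt0 t0 g0)).
    by congr (is_true (0 <= _)); field; rewrite gt_eqF.
  by rewrite !big_cons !big_nil/= !gamma_deriv0 GammaD1//; lra.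
have : 0 <= \sum_(p <- [:: (- 1, 1%N, x + 1); (ln (x + 1) - 1, 0%N, x + 1);
    ((x + 1)^-1, 0%N, x + 1 + 1)]) p.1.1 * gamma_deriv p.1.2 p.2.
  apply: gamma_deriv_comb_ge0 => [p|t t0].
    by rewrite !inE => /or3P[]/eqP->.
  rewrite !big_cons !big_nil/= (gE 1%N) (gamma_integrandM (x + 1) t0).
  have g0 := gamma_integrand0_gt0 (x + 1) t0.
  have := ln_le (t / (x + 1)) (divr_gt0 t0 x10); rewrite ln_div ?posrE// -subr_ge0.
  rewrite -(pmulr_lge0 _ g0).
  by congr (is_true (0 <= _)); ring.
rewrite !big_cons !big_nil/= !gamma_deriv0 (GammaD1 x11) mulKf ?gt_eqF//; lra.
Qed.

(** Trigamma is the variance of [ln t] under the weight [t^x e^(-t)]. It is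
    nonnegative as the mean of [(ln t - c)^2] for [c] the mean of [ln t], and at
    most the mean of that square for any other [c], such as [ln (x + 1)], where
    [sqr_ln_le] at [u = t/(x+1)] bounds it by [1 - 2 + (x + 1)/x = 1/x]. *)
Lemma trigamma_bounds (R : realType) (x : R) : 1 < x ->
  0 <= trigamma (x + 1) <= x^-1.
Proof.
move=> x1; have x0 : 0 < x by apply: lt_trans x1.
have x11 : 1 < x + 1 by lra.
have x10 : 0 < x + 1 by lra.
have x12 : 1 < x + 1 + 1 by lra.
have G0 := Gamma_gt0 x1; have G1 := Gamma_gt0 x11.
have gE k (t : R) : gamma_integrand k (x + 1) t =
    ln t ^+ k * gamma_integrand 0 (x + 1) t.
  by rewrite /gamma_integrand expr0 mul1r.
have d1 : gamma_deriv 1 (x + 1) = digamma (x + 1) * Gamma (x + 1).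
  by rewrite digammaE// divfK ?gt_eqF.
have d2 : gamma_deriv 2 (x + 1) =
    (trigamma (x + 1) + digamma (x + 1) ^+ 2) * Gamma (x + 1).
  by rewrite trigammaE// subrK divfK ?gt_eqF.
apply/andP; split.
  pose c := digamma (x + 1).
  have : 0 <= \sum_(p <- [:: (1, 2%N, x + 1); (- 2 * c, 1%N, x + 1);
      (c ^+ 2, 0%N, x + 1)]) p.1.1 * gamma_deriv p.1.2 p.2.
    apply: gamma_deriv_comb_ge0 => [p|t t0].
      by rewrite !inE => /or3P[]/eqP->.
    rewrite !big_cons !big_nil/= (gE 2%N) (gE 1%N).
    have g0 := gamma_integrand0_gt0 (x + 1) t0.
    rewrite (_ : _ + _ = (ln t - c) ^+ 2 * gamma_integrand 0 (x + 1) t); last first.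
      by ring.
    by rewrite mulr_ge0 ?sqr_ge0// ltW.
  rewrite !big_cons !big_nil/= !gamma_deriv0 d1 d2 /c.
  rewrite (_ : _ + _ = trigamma (x + 1) * Gamma (x + 1)); last by ring.
  by rewrite pmulr_lge0.
pose c := ln (x + 1).
have : 0 <= \sum_(p <- [:: (- 1, 2%N, x + 1); (2 * c, 1%N, x + 1);
    (- c ^+ 2 - 2, 0%N, x + 1); ((x + 1)^-1, 0%N, x + 1 + 1); (x + 1, 0%N, x)])
    p.1.1 * gamma_deriv p.1.2 p.2.
  apply: gamma_deriv_comb_ge0 => [p|t t0].
    by rewrite !inE => /orP[|/orP[|/or3P[]]]/eqP->.
  rewrite !big_cons !big_nil/= (gamma_integrandM (x + 1) t0) (gE 2%N) (gE 1%N).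
  rewrite (gamma_integrandM x t0).
  have g0 := gamma_integrand0_gt0 x t0.
  have := sqr_ln_le (divr_gt0 t0 x10); rewrite ln_div ?posrE// -/c -subr_ge0.
  rewrite -(pmulr_lge0 _ (mulr_gt0 t0 g0)).
  congr (is_true (0 <= _)); field.
  by rewrite !gt_eqF.
rewrite !big_cons !big_nil/= !gamma_deriv0 d1 d2 (GammaD1 x11).
have -> : Gamma x = Gamma (x + 1) / x by rewrite GammaD1// mulrC mulKf ?gt_eqF.
have sq : 0 <= (digamma (x + 1) - c) ^+ 2 * Gamma (x + 1).
  by rewrite mulr_ge0 ?sqr_ge0// ltW.
rewrite (_ : _ + _ = x^-1 * Gamma (x + 1) - trigamma (x + 1) * Gamma (x + 1) -
    (digamma (x + 1) - c) ^+ 2 * Gamma (x + 1)); last first.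
  by field; rewrite !gt_eqF.
by move=> H; rewrite -(ler_pM2r G1); lra.
Qed.

(** * From crude bounds to the sharp inequalities *)

Lemma exprVn_le_inv (R : realType) (y : R) (n : nat) : 1 < y ->
  0 < y^-1 ^+ n.+1 /\ y^-1 ^+ n.+1 <= y^-1.
Proof.
move=> y1; have y0 : 0 < y^-1 by rewrite invr_gt0 (lt_trans _ y1).
have y0' := ltW y0.
have yle : y^-1 <= 1 by rewrite invf_le1 ?ltW// (lt_trans _ y1).
by split; [exact: exprn_gt0|rewrite exprS ler_piMr// exprn_ile1].
Qed.

(** Rewriting [ln (y + 1) - ln y] as the logarithm of a ratio above [1] brings
    the increments of the error terms to the form of the logarithmic
    inequalities. *)
Lemma ln_succ (R : realType) (y : R) : 0 < y ->
  1 < (y + 1) / y /\ ln (y + 1) = ln ((y + 1) / y) + ln y.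
Proof.
move=> y0; split; first by rewrite ltr_pdivlMr//; lra.
by rewrite ln_div ?posrE ?subrK//; lra.
Qed.

Lemma digamma_sub_ln_bounds (R : realType) (y : R) : 1 < y ->
  0 <= digamma (y + 1) - ln y <= y^-1.
Proof.
move=> y1; have y0 : 0 < y by lra.
have /andP[l1 l2] := digamma_bounds y1; have [_ lE] := ln_succ y0.
have yi : 0 < y^-1 by rewrite invr_gt0.
have yiN1 : -1 < y^-1 by lra.
have := le_ln1Dx yiN1; rewrite (_ : 1 + y^-1 = (y + 1) / y); first lra.
by field; rewrite gt_eqF.
Qed.

Lemma digamma_succ (R : realType) (y : R) : 0 < y ->
  digamma (y + 1 + 1) = digamma (y + 1) + (y + 1)^-1.
Proof. by move=> y0; apply: digammaD1; lra. Qed.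

Lemma trigamma_succ (R : realType) (y : R) : 0 < y ->
  trigamma (y + 1 + 1) = trigamma (y + 1) - (y + 1) ^- 2.
Proof. by move=> y0; apply: trigammaD1; lra. Qed.

Lemma digamma_upper (R : realType) (x : R) : 0 < x ->
  digamma (x + 1) - ln x - 1 / (2 * x) < 0.
Proof.
pose h (y : R) := digamma (y + 1) - ln y - 1 / (2 * y).
move=> x0; apply: (@lt0_of_increasing_shift R h 1) => // y y0.
  have yn0 : y != 0 by rewrite gt_eqF.
  have y1n0 : y + 1 != 0 by rewrite gt_eqF// addr_gt0.
  have [w1 lE] := ln_succ y0; rewrite -subr_gt0 /h digamma_succ// lE.
  have := ln_lt_half_subV w1; rewrite -subr_gt0; congr (is_true (0 < _)).
  by field; apply/andP.
have yn0 : y != 0 by rewrite gt_eqF// (lt_trans _ y0).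
have yi : 0 < y^-1 by rewrite invr_gt0 (lt_trans _ y0).
have /andP[l u] := digamma_sub_ln_bounds y0.
have -> : h y = digamma (y + 1) - ln y - y^-1 / 2.
  by rewrite /h; field.
by rewrite mul1r ler_norml; apply/andP; split; lra.
Qed.

Lemma digamma_lower (R : realType) (x : R) : 0 < x ->
  ln x + 1 / (2 * x) - 1 / (12 * x ^+ 2) - digamma (x + 1) < 0.
Proof.
pose h (y : R) := ln y + 1 / (2 * y) - 1 / (12 * y ^+ 2) - digamma (y + 1).
move=> x0; apply: (@lt0_of_increasing_shift R h 1) => // y y0.
  have yn0 : y != 0 by rewrite gt_eqF.
  have y1n0 : y + 1 != 0 by rewrite gt_eqF// addr_gt0.
  have [w1 lE] := ln_succ y0; rewrite -subr_gt0 /h digamma_succ// lE.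
  have := ln_gt_half_subV w1; rewrite -subr_gt0; congr (is_true (0 < _)).
  by field; apply/andP.
have yn0 : y != 0 by rewrite gt_eqF// (lt_trans _ y0).
have [i2 i2'] := exprVn_le_inv 1 y0.
have /andP[l u] := digamma_sub_ln_bounds y0.
have -> : h y = y^-1 / 2 - y^-1 ^+ 2 / 12 - (digamma (y + 1) - ln y).
  by rewrite /h; field.
by rewrite mul1r ler_norml; apply/andP; split; lra.
Qed.

Lemma trigamma_upper (R : realType) (x : R) : 0 < x ->
  1 / (2 * x ^+ 2) - 1 / (6 * x ^+ 3) - (1 / x - trigamma (x + 1)) < 0.
Proof.
pose h (y : R) :=
  1 / (2 * y ^+ 2) - 1 / (6 * y ^+ 3) - (1 / y - trigamma (y + 1)).
move=> x0; apply: (@lt0_of_increasing_shift R h 2) => // y y0.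
  have yn0 : y != 0 by rewrite gt_eqF.
  have y1n0 : y + 1 != 0 by rewrite gt_eqF// addr_gt0.
  rewrite -subr_gt0 /h trigamma_succ//.
  (* The closed form of the increment of [h]. *)
  have : 0 < 1 / (6 * y ^+ 3 * (y + 1) ^+ 3).
    by apply: divr_gt0 => //; rewrite !mulr_gt0 ?exprn_gt0//; lra.
  by congr (is_true (0 < _)); field; apply/andP.
have yn0 : y != 0 by rewrite gt_eqF// (lt_trans _ y0).
have [i2 i2'] := exprVn_le_inv 1 y0; have [i3 i3'] := exprVn_le_inv 2 y0.
have /andP[l u] := trigamma_bounds y0.
have -> : h y = y^-1 ^+ 2 / 2 - y^-1 ^+ 3 / 6 - y^-1 + trigamma (y + 1).
  by rewrite /h; field.
by rewrite ler_norml; apply/andP; split; lra.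
Qed.

Lemma trigamma_lower (R : realType) (x : R) : 0 < x ->
  1 / x - trigamma (x + 1) -
    (1 / (2 * x ^+ 2) - 1 / (6 * x ^+ 3) + 1 / (30 * x ^+ 5)) < 0.
Proof.
pose h (y : R) := 1 / y - trigamma (y + 1) -
  (1 / (2 * y ^+ 2) - 1 / (6 * y ^+ 3) + 1 / (30 * y ^+ 5)).
move=> x0; apply: (@lt0_of_increasing_shift R h 2) => // y y0.
  have yn0 : y != 0 by rewrite gt_eqF.
  have y1n0 : y + 1 != 0 by rewrite gt_eqF// addr_gt0.
  rewrite -subr_gt0 /h trigamma_succ//.
  (* The closed form of the increment of [h]. *)
  have : 0 < (5 * y ^+ 2 + 5 * y + 1) / (30 * y ^+ 5 * (y + 1) ^+ 5).
    apply: divr_gt0; first by have := exprn_gt0 2 y0; lra.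
    by rewrite !mulr_gt0 ?exprn_gt0//; lra.
  by congr (is_true (0 < _)); field; apply/andP.
have yn0 : y != 0 by rewrite gt_eqF// (lt_trans _ y0).
have [i2 i2'] := exprVn_le_inv 1 y0; have [i3 i3'] := exprVn_le_inv 2 y0.
have [i5 i5'] := exprVn_le_inv 4 y0; have /andP[l u] := trigamma_bounds y0.
have -> : h y = y^-1 - trigamma (y + 1) -
    (y^-1 ^+ 2 / 2 - y^-1 ^+ 3 / 6 + y^-1 ^+ 5 / 30).
  by rewrite /h; field.
by rewrite ler_norml; apply/andP; split; lra.
Qed.

Theorem lemma1 (R : realType) (x : R) (hx : 0 < x) :
  (1 / (2 * x) - 1 / (12 * x ^+ 2) < digamma (x + 1) - ln x < 1 / (2 * x))
  /\
  (1 / (2 * x ^+ 2) - 1 / (6 * x ^+ 3) < 1 / x - trigamma (x + 1)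
     < 1 / (2 * x ^+ 2) - 1 / (6 * x ^+ 3) + 1 / (30 * x ^+ 5)).
Proof.
have U1 := digamma_upper hx; have U2 := digamma_lower hx.
have U3 := trigamma_upper hx; have U4 := trigamma_lower hx.
split; apply/andP; split.
- by rewrite -subr_lt0; apply: le_lt_trans U2; lra.
- by rewrite -subr_lt0.
- by rewrite -subr_lt0.
- by rewrite -subr_lt0.
Qed.
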